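(* Let $\sigma=\sigma_1\sigma_2\cdots\sigma_k$ be a Cayley permutation with $k\ge 2$, and let $\hat{\sigma}=\sigma_2\sigma_1\sigma_3\sigma_4\cdots\sigma_k$. If $\hat{\sigma}$ contains the pattern $231$, then $\mathrm{Sort}(\sigma)=\mathcal{C}(132,\sigma^r)$. In this case $\mathrm{Sort}(\sigma)$ is a class, whose basis is $\{132,\sigma^r\}$ if $\sigma^r$ avoids $132$, and $\{132\}$ otherwise.
   Context: A Cayley permutation is a finite word $\pi=\pi_1\cdots\pi_n$ over the positive integers such that every integer from $1$ to $\max(\pi)$ occurs at least once; $\mathcal{C}$ denotes the set of all Cayley permutations. A word $x=x_1\cdots x_n$ contains a pattern $p=p_1\cdots p_k\in\mathcal{C}$ if there are indices $i_1<\cdots<i_k$ such that for all $u,v$: $x_{i_u}<x_{i_v}$ iff $p_u<p_v$, and $x_{i_u}=x_{i_v}$ iff $p_u=p_v$; otherwise $x$ avoids $p$. For a set $B$ of patterns, $\mathcal{C}(B)$ (written $\mathcal{C}(p_1,\dots,p_m)$) is the set of Cayley permutations avoiding every pattern in $B$. A class is a subset of $\mathcal{C}$ closed downwards under pattern containment; its basis is the set of minimal (under containment) Cayley permutations not in the class. The reverse of $\pi=\pi_1\cdots\pi_n$ is $\pi^r=\pi_n\cdots\pi_1$. For a Cayley permutation $\tau$ of length at least two, a $\tau$-stack processes an input word from left to right with the following right-greedy algorithm: while the input is nonempty, if pushing the next input element onto the stack yields stack contents which, read from top to bottom, avoid $\tau$, the element is pushed; otherwise the top element of the stack is popped and appended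 to the output. When the input is exhausted, the remaining elements are popped one by one. Denote by $s_\tau(\pi)$ the output of the $\tau$-stack on input $\pi$. The $\sigma$-machine consists of a $\sigma$-stack followed in series by a $21$-stack: the output $s_\sigma(\pi)$ is used as input of a $21$-stack, operated by the same right-greedy algorithm with $\tau=21$ (so a letter may sit on a copy of itself). A Cayley permutation $\pi$ is $\sigma$-sortable if the final output of the $\sigma$-machine on input $\pi$ is weakly increasing; $\mathrm{Sort}(\sigma)$ denotes the set of $\sigma$-sortable Cayley permutations. *)

(* Defs.v *)
From mathcomp Require Import all_boot.

Set Implicit Arguments.
Unset Strict Implicit.
Unset Printing Implicit Defensive.

(* Plain MathComp.  Words are [seq nat]; positions are counted from 0.  The
   empty word is a Cayley permutation: its maximum is 0, so there is nothing
   that has to occur. *)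
Definition cayley (w : seq nat) : bool :=
  all (leq 1) w && all [in w] (iota 1 (\max_(a <- w) a)).

Definition contains (x p : seq nat) : bool :=
  [exists f : {ffun 'I_(size p) -> 'I_(size x)},
    [forall u : 'I_(size p), forall v : 'I_(size p),
      (u < v) ==> (f u < f v)] &&
    [forall u : 'I_(size p), forall v : 'I_(size p),
      ((nth 0 x (f u) < nth 0 x (f v)) == (nth 0 p u < nth 0 p v)) &&
      ((nth 0 x (f u) == nth 0 x (f v)) == (nth 0 p u == nth 0 p v))]].

Definition avoids (x p : seq nat) : bool := ~~ contains x p.

Definition avoiders (B : seq (seq nat)) : pred (seq nat) :=
  [pred w | cayley w && all (avoids w) B].

Definition is_class (A : pred (seq nat)) : Prop :=
  {subset A <= cayley} /\
  (forall x p, x \in A -> cayley p -> contains x p -> p \in A).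

(* A minimal element, for containment, of the complement of [A] in the set of
   Cayley permutations. *)
Definition minimal_excluded (A : pred (seq nat)) (b : seq nat) : Prop :=
  [/\ cayley b, b \notin A
    & forall c, cayley c -> c \notin A -> contains b c -> c = b].

Definition is_basis (A : pred (seq nat)) (B : seq (seq nat)) : Prop :=
  forall b, b \in B <-> minimal_excluded A b.

(* Stacks are listed from top to bottom.  [pop_then_push tau a st out] pops the
   stack [st] into the output [out] until [a] may be pushed, then pushes [a],
   and returns the new stack and output.  If [size tau >= 2], the one-letter
   word [a] avoids [tau], so the empty-stack branch is then a legal push. *)
Fixpoint pop_then_push (tau : seq nat) (a : nat) (st out : seq nat)
    : seq nat * seq nat :=
  if avoids (a :: st) tau then (a :: st, out)
  else if st is t :: st' then pop_then_push tau a st' (rcons out t)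
  else ([:: a], out).

Fixpoint run_stack (tau input st out : seq nat) : seq nat :=
  if input is a :: input' then
    let: (st', out') := pop_then_push tau a st out in
    run_stack tau input' st' out'
  else out ++ st.

Definition stack_output (tau w : seq nat) : seq nat := run_stack tau w [::] [::].

Definition sortable (sigma : seq nat) : pred (seq nat) :=
  [pred w | cayley w &&
    sorted leq (stack_output [:: 2; 1] (stack_output sigma w))].

Definition hat (sigma : seq nat) : seq nat :=
  if sigma is a :: b :: s then b :: a :: s else sigma.

(* Main.v *)
Require Import Defs.
From mathcomp Require Import all_boot.
From mathcomp Require Import zify.

Set Implicit Arguments.
Unset Strict Implicit.
Unset Printing Implicit Defensive.

(* As long as the reversed input avoids sigma nothing is popped, so an input
   avoiding [rev sigma] is merely reversed; and the 21-stack sorts a word iff it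
   avoids 231.  If instead some letter [a] forces pops, let [t] be the last
   letter popped for it and [st] what is left below.  Neither [t :: st] nor
   [a :: st] contains sigma but [a :: t :: st] does, so [a] and [t] play the
   first two letters of sigma; as [t] leaves before [a], the output contains
   [hat sigma], hence 231. *)

(** * Containment through order-isomorphic subsequences *)

Definition order_iso (y p : seq nat) : Prop :=
  size y = size p /\
  forall i j, i < size p -> j < size p ->
    (nth 0 y i < nth 0 y j) = (nth 0 p i < nth 0 p j).

Lemma order_iso_sym (y p : seq nat) : order_iso y p -> order_iso p y.
Proof. by case=> sz iso; split=> // i j; rewrite sz => hi hj; rewrite iso. Qed.

Lemma order_iso_rev (y p : seq nat) :
  order_iso y p -> order_iso (rev y) (rev p).
Proof.
case=> sz iso; split; first by rewrite !size_rev.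
by move=> i j; rewrite size_rev => hi hj; rewrite !nth_rev ?sz // iso //; lia.
Qed.

Lemma order_iso_hat (y p : seq nat) :
  1 < size p -> order_iso y p -> order_iso (hat y) (hat p).
Proof.
case: p y => [|p1 [|p2 p]] // [|y1 [|y2 y]] _ [sz iso] //.
pose swap i := if i is 0 then 1 else if i is 1 then 0 else i.
have nth_swap s (a b : nat) i :
  nth 0 (a :: b :: s) i = nth 0 (b :: a :: s) (swap i) by case: i => [|[]].
split=> // i j hi hj; rewrite !(nth_swap _ y2) !(nth_swap _ p2).
by apply: iso; [case: i hi => [|[]] | case: j hj => [|[]]].
Qed.

(** Strictly increasing index maps correspond to strictly sorted lists of positions, that is, to
    subsequences of [iota 0 (size x)]; reading [x] at these positions gives [y]. *)
Lemma containsP (x p : seq nat) :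
  reflect (exists2 y, subseq y x & order_iso y p) (contains x p).
Proof.
apply: (iffP existsP) => [[f /andP[/forallP f_mono /forallP f_iso]]|].
  have f_lt (u v : 'I_(size p)) : u < v -> f u < f v.
    by move/forallP: (f_mono u) => /(_ v)/implyP.
  have f_eq (u v : 'I_(size p)) :
      (nth 0 x (f u) < nth 0 x (f v)) = (nth 0 p u < nth 0 p v).
    by move/forallP: (f_iso u) => /(_ v)/andP[/eqP].
  pose s := [seq val (f u) | u <- enum 'I_(size p)].
  have sz_s : size s = size p by rewrite size_map size_enum_ord.
  have nth_s (u : 'I_(size p)) : nth 0 s u = f u.
    by rewrite (nth_map u) ?size_enum_ord // nth_ord_enum.
  have s_sorted : sorted ltn s.
    rewrite sorted_map; apply: (sub_sorted (e := relpre val ltn)).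
      by move=> u v; apply: f_lt.
    by rewrite -sorted_map val_enum_ord iota_ltn_sorted.
  have sub_s : subseq s (iota 0 (size x)).
    (* Two strictly sorted lists with the same elements are equal. *)
    suff -> : s = [seq i <- iota 0 (size x) | i \in s] by apply: filter_subseq.
    apply: (irr_sorted_eq ltn_trans ltnn) => //.
      by apply: sorted_filter; [apply: ltn_trans | apply: iota_ltn_sorted].
    move=> i; rewrite mem_filter mem_iota /=.
    by case si: (i \in s) => //; case/mapP: si => u _ ->; rewrite ltn_ord.
  exists [seq nth 0 x i | i <- s].
    have xE : [seq nth 0 x i | i <- iota 0 (size x)] = x.
      by rewrite map_nth_iota0 // take_size.
    by rewrite -[X in subseq _ X]xE map_subseq.
  split=> [|i j hi hj]; first by rewrite size_map.
  rewrite !(nth_map 0) ?sz_s //.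
  by rewrite (nth_s (Ordinal hi)) (nth_s (Ordinal hj)) f_eq.
case=> y /subseqP[m sz_m ->] [sz iso].
pose s := mask m (iota 0 (size x)).
have y_s : mask m x = [seq nth 0 x i | i <- s].
  by rewrite map_mask map_nth_iota0 // take_size.
rewrite y_s size_map in sz; rewrite y_s in iso.
have s_lt i : i < size p -> nth 0 s i < size x.
  rewrite -sz => /(mem_nth 0) /(mem_subseq (mask_subseq m _)).
  by rewrite mem_iota.
have s_sorted : sorted ltn s.
  by apply: sorted_mask; [apply: ltn_trans | apply: iota_ltn_sorted].
exists [ffun u : 'I_(size p) => Ordinal (s_lt u (ltn_ord u))].
have isoE (u v : 'I_(size p)) : (nth 0 x (nth 0 s u) < nth 0 x (nth 0 s v))
    = (nth 0 p u < nth 0 p v).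
  by rewrite -iso // !(nth_map 0) ?sz.
apply/andP; split; apply/forallP=> u; apply/forallP=> v; rewrite !ffunE /=.
  apply/implyP=> uv.
  by apply: (sorted_ltn_nth ltn_trans) => //; rewrite inE sz.
(* Equality is two non-strict inequalities, each the negation of a strict one, so the strict
   comparisons settle it. *)
by rewrite isoE eqxx !eqn_leq !(leqNgt (nth 0 x _)) !isoE -!leqNgt eqxx.
Qed.

Lemma contains_refl (x : seq nat) : contains x x.
Proof. by apply/containsP; exists x. Qed.

Lemma contains_trans (y x z : seq nat) :
  contains x y -> contains y z -> contains x z.
Proof.
move=> /existsP[g /andP[/forallP g_lt /forallP g_iso]].
move=> /existsP[f /andP[/forallP f_lt /forallP f_iso]].
apply/existsP; exists [ffun u => g (f u)].
apply/andP; split; apply/forallP=> u; apply/forallP=> v; rewrite !ffunE.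
  apply/implyP=> uv; move/forallP: (f_lt u) => /(_ v)/implyP/(_ uv) fuv.
  by move/forallP: (g_lt (f u)) => /(_ (f v))/implyP/(_ fuv).
move/forallP: (f_iso u) => /(_ v)/andP[/eqP <- /eqP <-].
by move/forallP: (g_iso (f u)) => /(_ (f v)).
Qed.

Lemma contains_subseq (x y : seq nat) : subseq y x -> contains x y.
Proof. by move=> yx; apply/containsP; exists y. Qed.

Lemma subseq_cat_split (s x y : seq nat) :
  subseq s (x ++ y) -> exists i, subseq (take i s) x /\ subseq (drop i s) y.
Proof.
elim: x s => [|a x IHx] s /=; first by exists 0; rewrite take0 drop0.
case: s => [_|b s]; first by exists 0; rewrite !sub0seq.
case: eqP => [->|_] /IHx[i [hx hy]]; first by exists i.+1; rewrite /= eqxx.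
by exists i; split=> //; apply: subseq_trans hx (subseq_cons _ _).
Qed.

Lemma contains_size (x p : seq nat) : contains x p -> size p <= size x.
Proof. by case/containsP=> y /size_subseq le_yx [<- _]. Qed.

Lemma contains_rev (x p : seq nat) :
  contains (rev x) (rev p) = contains x p.
Proof.
have imp a b : contains a b -> contains (rev a) (rev b).
  case/containsP=> y ya yb; apply/containsP; exists (rev y).
    by rewrite subseq_rev.
  exact: order_iso_rev.
by apply/idP/idP=> [/imp|/imp//]; rewrite !revK.
Qed.

Lemma contains231P (x : seq nat) :
  reflect (exists b c d, [/\ subseq [:: b; c; d] x, d < b & b < c])
          (contains x [:: 2; 3; 1]).
Proof.
apply: (iffP (containsP _ _)) => [[y yx [sz iso]]|[b [c [d [yx db bc]]]]].
  case: y sz yx iso => [|b [|c [|d []]]] // _ yx iso.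
  by exists b, c, d; split=> //; [rewrite (iso 2 0) | rewrite (iso 0 1)].
exists [:: b; c; d] => //; split=> // i j.
by case: i => [|[|[|]]] //; case: j => [|[|[|]]] //= _ _; lia.
Qed.

Lemma avoids21 (x : seq nat) : avoids x [:: 2; 1] = sorted leq x.
Proof.
apply/idP/idP=> [av|x_sorted].
  rewrite (sorted_pairwise leq_trans).
  elim: x av => //= a x IHx av; apply/andP; split; last first.
    apply: IHx; apply: contraNN av; apply: contains_trans.
    exact/contains_subseq/subseq_cons.
  apply/allP=> b bx; rewrite leqNgt; apply: contraNN av => ba.
  apply/containsP; exists [:: a; b]; first by rewrite /= eqxx sub1seq.
  by split=> // -[|[|i]] [|[|j]] //= _ _; lia.
apply/containsP=> -[y yx [sz iso]].
case: y sz yx iso => [|b [|a []]] // _ yx /(_ 1 0 isT isT) /= ab.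
have := subseq_sorted leq_trans yx x_sorted.
by rewrite /= andbT leqNgt ab.
Qed.

(** * Cayley permutations as pattern representatives; classes and bases *)

Lemma order_iso_cayley_eq (x p : seq nat) :
  cayley x -> cayley p -> order_iso x p -> x = p.
Proof.
(* Induction on the letter of [a]: if it is [k.+2], then [k.+1] also occurs in [a], and the
   counterpart of that occurrence in [b] is at least [k.+1] and strictly below [nth 0 b i].
   Exchanging the words gives equality. *)
have le_nth a b : cayley a -> cayley b -> order_iso a b ->
    forall i, i < size a -> nth 0 a i <= nth 0 b i.
  move=> /andP[a_pos /allP a_full] /andP[/allP b_pos _] [sz iso] i.
  have [m] := ubnP (nth 0 a i); elim: m i => // m IHm i le_am hi.
  have b_gt0 : 0 < nth 0 b i by apply: b_pos; rewrite mem_nth -?sz.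
  case aiE: (nth 0 a i) => [|[|k]] //.
  have : k.+1 \in a.
    apply: a_full; rewrite mem_iota /= add1n ltnS.
    have : nth 0 a i <= \max_(c <- a) c.
      by apply: (leq_bigmax_seq (F := id)); rewrite ?mem_nth.
    by rewrite aiE; apply: ltnW.
  move=> ka; have hj : index k.+1 a < size a by rewrite index_mem.
  have ajE := nth_index 0 ka.
  have := iso (index k.+1 a) i; rewrite -sz ajE aiE ltnSn => /(_ hj hi) bji.
  have := IHm (index k.+1 a); rewrite ajE => /(_ _ hj) le_kb.
  apply: leq_ltn_trans (esym bji); apply: le_kb.
  by move: le_am; rewrite aiE.
move=> cx cp iso; have [sz _] := iso.
apply: (eq_from_nth (x0 := 0)) => // i hi; apply/eqP; rewrite eqn_leq.
rewrite (le_nth x p) //= (le_nth p x) -?sz //; exact: order_iso_sym.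
Qed.

Lemma contains_cayley_eq (x p : seq nat) :
  cayley x -> cayley p -> contains x p -> size x <= size p -> x = p.
Proof.
move=> cx cp /containsP[y yx yp] le_xp; apply: order_iso_cayley_eq => //.
have [sz_y _] := yp; suff <- : y = x by [].
apply/eqP; rewrite -(size_subseq_leqif yx).2 eqn_leq size_subseq //=.
by rewrite sz_y.
Qed.

Lemma cayley_rev (w : seq nat) : cayley w -> cayley (rev w).
Proof.
rewrite /cayley all_rev => /andP[-> /=].
rewrite [in X in _ -> X](perm_big w) ?perm_rev // => /allP w_full.
by apply/allP=> a a_le; rewrite mem_rev; apply: w_full.
Qed.

Lemma avoiders_class (B : seq (seq nat)) : is_class (avoiders B).
Proof.
split=> [w /andP[] //|x p /andP[_ /allP x_av] cp xp].
rewrite inE cp; apply/allP=> q qB; apply: contraNN (x_av q qB).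
exact: contains_trans xp.
Qed.

(** A Cayley permutation is excluded exactly when it contains a pattern of [B], so a minimal
    excluded one is such a pattern; the antichain condition makes every pattern of [B] minimal. *)
Lemma avoiders_basis (B : seq (seq nat)) :
  {in B, forall p, cayley p} ->
  {in B &, forall p q, contains p q -> p = q} ->
  is_basis (avoiders B) B.
Proof.
move=> cB anti b.
have excluded p : p \in B -> p \notin avoiders B.
  move=> pB; rewrite inE cB //=; apply/allPn; exists p => //.
  by rewrite /avoids negbK contains_refl.
have witness c : cayley c -> c \notin avoiders B ->
    exists2 p, p \in B & contains c p.
  by rewrite inE => -> /allPn[p pB]; rewrite negbK; exists p.
split=> [bB|[cb b_out b_min]].
  split=> [||c cc c_out bc]; [exact: cB | exact: excluded |].
  (* [b] contains [c] and [c] contains [p], which forces [b = p]; then [b] and [c] contain each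
     other and have the same length. *)
  have [p pB cp] := witness c cc c_out.
  have bp := anti b p bB pB (contains_trans bc cp).
  apply: contains_cayley_eq => //; last exact: contains_size.
    exact: cB.
  by rewrite bp.
have [p pB bp] := witness b cb b_out.
by rewrite -(b_min p (cB p pB) (excluded p pB) bp).
Qed.

Lemma is_basis_eq (A A' : pred (seq nat)) (B : seq (seq nat)) :
  A =i A' -> is_basis A B -> is_basis A' B.
Proof.
move=> eqA basis b; rewrite basis.
by split=> -[cb b_out b_min]; split=> // [|c cc c_out];
  [rewrite -eqA | apply: b_min; rewrite ?eqA
  |rewrite eqA | apply: b_min; rewrite -?eqA].
Qed.

(** * Output of a [tau]-stack *)

Lemma pop_then_push_subseq (tau : seq nat) (a : nat) (st out : seq nat) :
  let r := pop_then_push tau a st out in subseq (out ++ st) (r.2 ++ r.1).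
Proof.
elim: st out => [|t st IHst] out /=; case: ifP => _ /=.
- by rewrite cats0 prefix_subseq.
- by rewrite cats0 prefix_subseq.
- by rewrite subseq_cat2l subseq_cons.
- by rewrite -cat_rcons; apply: IHst.
Qed.

(** Popping leaves the word [out ++ st] unchanged and pushing inserts a letter into it, so a pattern
    found there reaches the final output. *)
Lemma run_stack_subseq (tau w st out : seq nat) :
  subseq (out ++ st) (run_stack tau w st out).
Proof.
elim: w st out => //= a w IHw st out.
have := pop_then_push_subseq tau a st out.
by case: pop_then_push => st' out' /= h; apply: subseq_trans (IHw _ _).
Qed.

(** [rev w ++ st] is the stack once all of [w] is pushed; every intermediate stack is a suffix of
    it, so no push is blocked. *)
Lemma run_stack_no_pop (tau w st out : seq nat) :
  avoids (rev w ++ st) tau -> run_stack tau w st out = out ++ rev w ++ st.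
Proof.
elim: w st out => //= a w IHw st out; rewrite rev_cons cat_rcons => av.
have av' : avoids (a :: st) tau.
  apply: contraNN av; apply: contains_trans.
  exact/contains_subseq/suffix_subseq.
have -> : pop_then_push tau a st out = (a :: st, out).
  by case: st av' {av} => [|t st] /= ->.
exact: IHw.
Qed.

(* An occurrence of [tau] using both top letters survives, with these two
   exchanged, when [t] is popped and [a] is pushed in its place. *)
Lemma contains_hat_swap (tau : seq nat) (a t : nat) (st : seq nat) :
  1 < size tau -> avoids (t :: st) tau -> avoids (a :: st) tau ->
  contains (a :: t :: st) tau -> contains (t :: a :: st) (hat tau).
Proof.
move=> sz_tau av_t av_a /containsP[y y_sub iso].
have in_tau s : subseq y s -> contains s tau.
  by move=> ys; apply/containsP; exists y.
have [sz_y _] := iso; apply/containsP.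
exists (hat y); last exact: order_iso_hat.
case: y sz_y y_sub in_tau {iso} => [|y1 [|y2 y]];
  try by move=> sz_y; move: sz_tau; rewrite -sz_y.
rewrite /hat /= => _; case: eqP => [->|_] y_sub in_tau; last first.
  by move/negP: av_t; case; apply: in_tau.
case: ifP y_sub => _ y_sub; first by rewrite eqxx.
by move/negP: av_a; case; apply: in_tau; rewrite /= eqxx.
Qed.

Lemma pop_then_push_hat (tau : seq nat) (a : nat) (st out : seq nat) :
  1 < size tau -> avoids st tau -> contains (a :: st) tau ->
  let r := pop_then_push tau a st out in contains (r.2 ++ r.1) (hat tau).
Proof.
move=> sz_tau; elim: st out => [|t st IHst] out av_st con.
  by move/contains_size: con; rewrite leqNgt sz_tau.
have -> : pop_then_push tau a (t :: st) out
    = pop_then_push tau a st (rcons out t) by rewrite /= {1}/avoids con.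
have av_st' : avoids st tau.
  apply: contraNN av_st; apply: contains_trans.
  exact/contains_subseq/subseq_cons.
(* If [a] is still blocked, popping goes on. Otherwise [t] is the last letter popped, and output
   followed by stack ends in [t :: a :: st]. *)
have [con_a|av_a] := boolP (contains (a :: st) tau); first exact: IHst.
have -> : pop_then_push tau a st (rcons out t) = (a :: st, rcons out t).
  by case: (st) av_a => [|u st'] /= av_a; rewrite /avoids av_a.
apply: (@contains_trans (t :: a :: st)); last exact: contains_hat_swap.
by apply: contains_subseq; rewrite /= cat_rcons suffix_subseq.
Qed.

(** Successful pushes do not change [rev w ++ st]. It contains [tau] while the stack avoids it, so
    some letter is blocked before the input ends. *)
Lemma run_stack_hat (tau w st out : seq nat) :
  1 < size tau -> avoids st tau -> contains (rev w ++ st) tau ->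
  contains (run_stack tau w st out) (hat tau).
Proof.
move=> sz_tau; elim: w st out => [|a w IHw] st out av_st con.
  by rewrite /avoids con in av_st.
rewrite /=; have [con_a|av_a] := boolP (contains (a :: st) tau).
  have := pop_then_push_hat out sz_tau av_st con_a.
  case: pop_then_push => st' out' /=; apply: contains_trans.
  exact/contains_subseq/run_stack_subseq.
have -> : pop_then_push tau a st out = (a :: st, out).
  by case: st av_a {av_st con} => [|u st] /= av_a; rewrite /avoids av_a.
by apply: IHw => //; rewrite -cat_rcons -rev_cons.
Qed.

(** * The 21-stack and the pattern 231 *)

Lemma sorted_rcons_leq (s : seq nat) (t : nat) :
  sorted leq (rcons s t) = sorted leq s && all (geq t) s.
Proof.
by rewrite !(sorted_pairwise leq_trans) pairwise_rcons andbC.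
Qed.

(* An invariant of the 21-stack: for a sorted stack [st], it holds iff the final
   output is sorted. *)
Definition sorts21 (w st out : seq nat) : Prop :=
  [/\ sorted leq out, allrel leq out (st ++ w)
    & avoids (rev st ++ w) [:: 2; 3; 1]].

Lemma sorts21_push (a : nat) (w st out : seq nat) :
  sorts21 (a :: w) st out <-> sorts21 w (a :: st) out.
Proof.
rewrite /sorts21 rev_cons cat_rcons.
suff -> : allrel leq out (st ++ a :: w) = allrel leq out ((a :: st) ++ w) by [].
by apply: eq_allrel_memr => // b; rewrite !(mem_cat, inE) orbCA orbA.
Qed.

(** A letter [d < t] of [w] would give the 231 occurrence [t], [a], [d], so avoidance makes [t] a
    lower bound of the remaining letters, as the longer output requires. Conversely, such a [t] lies
    in no occurrence. *)
Lemma sorts21_pop (t a : nat) (w st out : seq nat) :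
  sorted leq (t :: st) -> t < a ->
  sorts21 (a :: w) (t :: st) out <-> sorts21 (a :: w) st (rcons out t).
Proof.
move=> st_sorted ta; rewrite /sorts21 sorted_rcons_leq rev_cons cat_rcons.
have t_le : all (leq t) st := order_path_min leq_trans st_sorted.
have st_sorted' := path_sorted st_sorted.
rewrite -cats1 allrel_catl allrel1l all_cat t_le /= (ltnW ta) /=.
rewrite allrel_consr.
split=> [[-> /andP[out_t ->] av] | [/andP[-> out_t] /andP[-> t_w] av]].
  split=> //=; last first.
    apply: contraNN av; apply: contains_trans.
    exact/contains_subseq/cat_subseq/subseq_cons/subseq_refl.
  apply/allP=> d dw; rewrite leqNgt; apply: contraNN av => dt.
  apply/contains231P; exists t, a, d; split=> //.
  by apply: subseq_trans (suffix_subseq _ _); rewrite /= !eqxx sub1seq.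
split=> //; first by rewrite out_t.
apply: contraNN av => /contains231P[b [c [d [sub db bc]]]].
apply/contains231P; exists b, c, d; split=> //.
(* The reversed stack is weakly decreasing, so it has no ascent. *)
have dec : ~ subseq [:: b; c] (rev st).
  rewrite -subseq_rev revK => /(subseq_sorted leq_trans)/(_ st_sorted').
  by rewrite /= andbT leqNgt bc.
have le_t u : u \in rev st -> t <= u.
  by rewrite mem_rev; apply: (allP t_le).
have sub_cons u v : subseq (u :: v) [:: t, a & w] ->
    u = t /\ subseq v (a :: w) \/ subseq (u :: v) (a :: w).
  rewrite [subseq _ _]/(subseq (if u == t then v else u :: v) (a :: w)).
  by case: eqP => [->|_]; [left | right].
(* Split by how many letters of the occurrence lie in [rev st]. With none, [t] could only be [b],
   but nothing later is below it; with one, only [c], but [b] is at least [t]; more contradict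
   [dec]. *)
have [[|[|i]] [sub_st sub_w]] := subseq_cat_split sub.
- rewrite drop0 in sub_w.
  have {sub_w} [[b_t sub_w]|sub_w] := sub_cons _ _ sub_w; last first.
    exact: subseq_trans sub_w (suffix_subseq _ _).
  have : d \in a :: w by apply: (mem_subseq sub_w); rewrite !inE eqxx orbT.
  rewrite inE => /predU1P[da|/(allP t_w)]; last by rewrite leqNgt -b_t db.
  by move: ta; rewrite -b_t -da ltnNge (ltnW db).
- have b_st : b \in rev st by rewrite -sub1seq.
  have {sub_w} [[c_t _]|sub_w] := sub_cons _ _ sub_w.
    by have := le_t b b_st; rewrite leqNgt -c_t bc.
  by rewrite -cat1s; apply: cat_subseq => //; rewrite sub1seq.
- case: dec; apply: subseq_trans sub_st => /=.
  by rewrite !eqxx sub0seq.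
Qed.

Lemma pop_then_push21 (a : nat) (w st out : seq nat) :
  sorted leq st ->
  let r := pop_then_push [:: 2; 1] a st out in
  sorted leq r.1 /\ (sorts21 w r.1 r.2 <-> sorts21 (a :: w) st out).
Proof.
elim: st out => [|t st IHst] out st_sorted; rewrite /= avoids21.
  by split=> //; rewrite sorts21_push.
case: ifPn => [a_sorted|a_unsorted]; first by split=> //; rewrite sorts21_push.
have [r_sorted r_out] := IHst (rcons out t) (path_sorted st_sorted).
split=> //; rewrite r_out -sorts21_pop //.
move: a_unsorted; rewrite /= -[path _ t st]/(sorted leq (t :: st)).
by rewrite st_sorted andbT -ltnNge.
Qed.

Lemma run_stack21_sorted (w st out : seq nat) :
  sorted leq st ->
  sorted leq (run_stack [:: 2; 1] w st out) <-> sorts21 w st out.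
Proof.
elim: w st out => [|a w IHw] st out st_sorted /=; last first.
  have := pop_then_push21 a w out st_sorted.
  by case: pop_then_push => st' out' [/= st'_sorted <-]; apply: IHw.
rewrite /sorts21 !cats0 !(sorted_pairwise leq_trans) pairwise_cat.
rewrite -!(sorted_pairwise leq_trans) st_sorted andbT.
split=> [/andP[-> ->]|[-> -> //]]; split=> //.
(* With no input left the 231 condition is automatic, since [rev st] is weakly decreasing. *)
apply/contains231P=> -[b [c [d [sub _ bc]]]].
have : subseq [:: c; b] st.
  rewrite -subseq_rev; apply: subseq_trans sub.
  by rewrite -[rev _]/[:: b; c] /= !eqxx.
by move/(subseq_sorted leq_trans)/(_ st_sorted); rewrite /= andbT leqNgt bc.
Qed.

Lemma stack21_sorted (w : seq nat) :
  sorted leq (stack_output [:: 2; 1] w) = avoids w [:: 2; 3; 1].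
Proof.
apply/idP/idP=> [/(run_stack21_sorted w [::] (isT : sorted leq [::]))[]//|av].
by apply/run_stack21_sorted.
Qed.

(** * Sortable words and their basis *)

Lemma sortable_avoiders (sigma : seq nat) :
  1 < size sigma -> contains (hat sigma) [:: 2; 3; 1] ->
  sortable sigma =i avoiders [:: [:: 1; 3; 2]; rev sigma].
Proof.
move=> sz_sigma hat_231 w; rewrite !inE /= andbT stack21_sorted; congr (_ && _).
have rev_sigma : contains w (rev sigma) = contains (rev w) sigma.
  by rewrite -contains_rev revK.
have [con|av] := boolP (contains w (rev sigma)).
  rewrite /avoids con andbF; apply/negbTE; rewrite negbK.
  apply: contains_trans hat_231; apply: run_stack_hat => //.
    by apply: contraL sz_sigma => /contains_size; case: (size sigma).
  by rewrite cats0 -rev_sigma.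
(* The first stack outputs [rev w], where 231 corresponds to 132 in [w]. *)
rewrite {2 3}/avoids av andbT /stack_output run_stack_no_pop ?cats0 //=.
  by rewrite /avoids -[[:: 2; 3; 1]]/(rev [:: 1; 3; 2]) contains_rev.
by rewrite /avoids -rev_sigma.
Qed.

Theorem theorem2 (sigma : seq nat)
    (cayley_sigma : cayley sigma) (size_sigma : 2 <= size sigma)
    (hat_231 : contains (hat sigma) [:: 2; 3; 1]) :
  [/\ sortable sigma =i avoiders [:: [:: 1; 3; 2]; rev sigma],
      is_class (sortable sigma),
      avoids (rev sigma) [:: 1; 3; 2] ->
        is_basis (sortable sigma) [:: [:: 1; 3; 2]; rev sigma]
    & ~~ avoids (rev sigma) [:: 1; 3; 2] ->
        is_basis (sortable sigma) [:: [:: 1; 3; 2]]].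
Proof.
have sortE := sortable_avoiders size_sigma hat_231.
have cayley132 : cayley [:: 1; 3; 2] by rewrite /cayley !big_cons big_nil.
(* At this length [rev sigma] lies in 132 only if the two are equal, as the antichain condition
   asks. *)
have size3 : 3 <= size (rev sigma).
  move/contains_size: hat_231; rewrite size_rev.
  by case: (sigma) => [|? []].
split=> //.
- have [sub down] := avoiders_class [:: [:: 1; 3; 2]; rev sigma].
  by split=> [w|x p]; rewrite !sortE; [apply: sub | apply: down].
- move=> av; apply: (is_basis_eq (A := avoiders [:: [:: 1; 3; 2]; rev sigma])).
    by move=> w; rewrite sortE.
  apply: avoiders_basis => [p|p q]; rewrite !inE.
    by case/orP=> /eqP-> //; apply: cayley_rev.
  case/orP=> /eqP-> /orP[]/eqP-> // con; last by rewrite /avoids con in av.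
  by apply: contains_cayley_eq => //; apply: cayley_rev.
- rewrite negbK => con; apply: (is_basis_eq (A := avoiders [:: [:: 1; 3; 2]])).
    move=> w; rewrite sortE !inE /= !andbT; congr (_ && _).
    (* Here [rev sigma] contains 132, so avoiding 132 already implies avoiding [rev sigma]. *)
    apply/idP/andP=> [av|[] //]; split=> //; apply: contraNN av => w_sigma.
    exact: contains_trans con.
  by apply: avoiders_basis => [p|p q]; rewrite !inE => /eqP-> // /eqP->.
Qed.
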